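(* Let $\gamma$ and $\widetilde{\gamma}$ be two compositions of $n$ such that $\gamma\le\widetilde{\gamma}$. For any composition $\alpha$ of $n$ with $\alpha\le\gamma$, the branching rule from the $\gamma$-Schur functions to the $\widetilde{\gamma}$-Schur functions is $$\mathbf{R}_{\alpha}^{(\gamma)}(A;t)=\sum_{\substack{\beta\ge\alpha\\ D(\alpha)\setminus D(\beta)\subseteq D(\gamma)\setminus D(\widetilde{\gamma})}}t^{c(\alpha,\beta^{c})}\,\mathbf{R}_{\beta}^{(\widetilde{\gamma})}(A;t).$$
   Context: A composition $\alpha=(\alpha_1,\ldots,\alpha_{l(\alpha)})$ of $n$ is a sequence of positive integers with sum $n$; $l(\alpha)$ is its length. Its descent set is $D(\alpha)=\{\alpha_1,\alpha_1+\alpha_2,\ldots,\alpha_1+\cdots+\alpha_{l(\alpha)-1}\}\subseteq\{1,\ldots,n-1\}$; this gives a bijection between compositions of $n$ and subsets of $\{1,\ldots,n-1\}$. Refinement order on compositions of $n$: $\alpha\le\beta$ iff $D(\beta)\subseteq D(\alpha)$. The complement $\alpha^c$ is the composition of $n$ with $D(\alpha^c)=\{1,\ldots,n-1\}\setminus D(\alpha)$. For compositions $\alpha,\beta$ of $n$, $c(\alpha,\beta)=\sum_{i\in D(\alpha)\cap D(\beta)}i$. $\mathbf{Sym}=\mathbb{C}(q,t)\langle\mathbf{h}_1,\mathbf{h}_2,\ldots\rangle$ is the free associative algebra of non-commutative symmetric functions; $\mathbf{h}_\alpha(A)=\mathbf{h}_{\alpha_1}\cdots\mathbf{h}_{\alpha_{l(\alpha)}}$.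 The ribbon Schur functions are $\mathbf{R}_\alpha(A)=\sum_{\beta\ge\alpha}(-1)^{l(\alpha)-l(\beta)}\mathbf{h}_\beta(A)$. For compositions $\alpha\le\gamma$ of $n$, the $\gamma$-ribbon Schur function (also called $\gamma$-Schur function) is $$\mathbf{R}_\alpha^{(\gamma)}(A;t)=\sum_{\substack{\beta\ge\alpha\\ D(\alpha)\setminus D(\beta)\subseteq D(\gamma)}}t^{c(\alpha,\beta^c)}\mathbf{R}_\beta(A).$$ *)

(* Defs.v *)
From HB Require Import structures.
From mathcomp Require Import all_boot all_order all_algebra.
From mathcomp Require Import fraction reals complex.
From mathcomp.multinomials Require Import monalg.

Set Implicit Arguments.
Unset Strict Implicit.
Unset Printing Implicit Defensive.

Import GRing.Theory.

Record composition (n : nat) := Composition {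
  parts :> seq nat;
  compositionP : all (leq 1) parts && (sumn parts == n)
}.

HB.instance Definition _ n := [isSub for @parts n].
HB.instance Definition _ n := [Countable of composition n by <:].

(* The descent set, a subset of {1, ..., n-1}, is encoded as a subset of
   'I_n = {0, ..., n-1} which never contains 0. *)
Definition descents n (a : composition n) : {set 'I_n} :=
  [set i : 'I_n | [exists k : 'I_(size a), (0 < k) && (i == sumn (take k a) :> nat)]].

(* Consecutive differences of 0 < d_1 < ... < d_k < n, for A = {d_1, ..., d_k};
   the filter only acts if 0 \in A or n = 0. *)
Definition parts_of_descents n (A : {set 'I_n}) : seq nat :=
  [seq d <- pairmap (fun x y => y - x) 0 (rcons [seq val i | i in A] n) | 0 < d].

Lemma foldl_addn x s : foldl addn x s = x + sumn s.
Proof. by elim: s x => [|y s IH] x /=; rewrite ?addn0 // IH addnA. Qed.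

Lemma last_scanl_addn x s : last x (scanl addn x s) = x + sumn s.
Proof. by elim: s x => [|y s IH] x /=; rewrite ?addn0 // IH addnA. Qed.

Lemma sumn_pairmap x s : path leq x s ->
  x + sumn (pairmap (fun x y => y - x) x s) = last x s.
Proof.
by elim: s x => [|y s IH] x /=; rewrite ?addn0 // => /andP[xy ys]; rewrite addnA subnKC ?IH.
Qed.

Lemma scanl_pairmap x s : path leq x s ->
  scanl addn x (pairmap (fun x y => y - x) x s) = s.
Proof. by elim: s x => [|y s IH] x //= /andP[xy ys]; rewrite subnKC ?IH. Qed.

Lemma pairmap_scanl x s : pairmap (fun x y => y - x) x (scanl addn x s) = s.
Proof. by elim: s x => [|y s IH] x //=; rewrite IH addKn. Qed.

Lemma path_scanl x s : all (leq 1) s -> path ltn x (scanl addn x s).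
Proof.
by elim: s x => [|y s IH] x //= /andP[y0 /IH->]; rewrite -[X in X < _]addn0 ltn_add2l y0.
Qed.

Lemma pairmap_gt0 x s :
  path ltn x s -> all (leq 1) (pairmap (fun x y => y - x) x s).
Proof. by elim: s x => [|y s IH] x //= /andP[xy /IH->]; rewrite subn_gt0 xy. Qed.

Lemma sumn_filter_gt0 s : sumn [seq d <- s | 0 < d] = sumn s.
Proof. by elim: s => [|[|y] s IH] //=; rewrite IH. Qed.

Lemma image_val_ord n (A : {set 'I_n}) :
  [seq val i | i in A] = [seq m <- iota 0 n | m \in [seq val i | i in A]].
Proof.
rewrite -val_enum_ord filter_map; congr map; rewrite {1}/enum_mem enumT.
by apply: eq_filter => i /=; rewrite (mem_map val_inj) mem_enum.
Qed.

Lemma sorted_image n (A : {set 'I_n}) : sorted ltn [seq val i | i in A].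
Proof.
rewrite image_val_ord; apply: sorted_filter; first exact: ltn_trans.
exact: iota_ltn_sorted.
Qed.

Lemma mem_image_lt n (A : {set 'I_n}) m : m \in [seq val i | i in A] -> m < n.
Proof. by case/mapP=> i _ ->; exact: ltn_ord. Qed.

Lemma sorted_rcons_image n (A : {set 'I_n}) :
  sorted ltn (rcons [seq val i | i in A] n).
Proof.
rewrite (sorted_pairwise ltn_trans) pairwise_rcons -sorted_pairwise; last exact: ltn_trans.
by rewrite sorted_image andbT; apply/allP => m /mem_image_lt.
Qed.

Lemma path_leq_rcons_image n (A : {set 'I_n}) :
  path leq 0 (rcons [seq val i | i in A] n).
Proof.
rewrite (path_sortedE leq_trans); apply/andP; split; first by apply/allP.
exact: (sub_sorted ltnW) (sorted_rcons_image A).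
Qed.

Lemma parts_of_descentsP n (A : {set 'I_n}) :
  all (leq 1) (parts_of_descents A) && (sumn (parts_of_descents A) == n).
Proof.
rewrite /parts_of_descents filter_all sumn_filter_gt0 /=.
by rewrite -[sumn _]add0n sumn_pairmap ?path_leq_rcons_image // last_rcons.
Qed.

Definition of_descents n (A : {set 'I_n}) : composition n :=
  Composition (parts_of_descentsP A).

Lemma mem_descents n (a : composition n) (i : 'I_n) :
  (i \in descents a) = ((i : nat) \in scanl addn 0 a).
Proof.
have [_ /eqP sa] := andP (compositionP a).
rewrite inE; apply/existsP/(nthP 0) => [[k /andP[k0 /eqP->]]|[k]].
  exists k.-1; first by rewrite size_scanl; case: (nat_of_ord k) k0 (ltn_ord k) => //= m _ /ltnW.
  by rewrite nth_scanl ?foldl_addn ?add0n prednK // ltnW.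
rewrite size_scanl => ks; rewrite nth_scanl // foldl_addn add0n => ki.
have lt_k : k.+1 < size a.
  rewrite ltn_neqAle ks andbT; apply/eqP => e.
  by move: ki (ltn_ord i); rewrite e take_size sa => <-; rewrite ltnn.
by exists (Ordinal lt_k); rewrite /= ki.
Qed.

Lemma scanl_descents n (a : composition n) : 0 < n ->
  scanl addn 0 a = rcons [seq val i | i in descents a] n.
Proof.
move=> n0; have [a1 /eqP sa] := andP (compositionP a).
have sS : sorted ltn (scanl addn 0 a) := path_sorted (path_scanl 0 a1).
apply: (irr_sorted_eq ltn_trans ltnn) => //; first exact: sorted_rcons_image.
have lS := last_scanl_addn 0 a; rewrite add0n sa in lS.
case/lastP E: (scanl addn 0 a) => [|s z]; first by rewrite E in lS; rewrite -lS in n0.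
rewrite E last_rcons in lS; subst z => m; rewrite !mem_rcons !inE.
case: eqVneq => //= mn.
have lt_s : m \in s -> m < n.
  move: sS; rewrite E (sorted_pairwise ltn_trans) pairwise_rcons => /andP[/allP h _].
  exact: h.
apply/idP/mapP => [ms|[i i_in ->]].
  exists (Ordinal (lt_s ms)) => //.
  by rewrite mem_enum mem_descents E mem_rcons inE /= ms orbT.
move: i_in; rewrite mem_enum mem_descents E mem_rcons inE => /orP[/eqP e|//].
by move: (ltn_ord i); rewrite e ltnn.
Qed.

Lemma descentsK n : cancel (@descents n) (@of_descents n).
Proof.
move=> a; apply: val_inj; rewrite /= /parts_of_descents.
have [a1 /eqP sa] := andP (compositionP a).
case: (posnP n) => [n0|n0]; last first.
  by rewrite -scanl_descents // pairmap_scanl; apply/all_filterP.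
have -> : [seq val i | i in descents a] = [::].
  by apply/eqP; rewrite -size_eq0 size_image -leqn0 -[X in _ <= X]n0 -[X in _ <= X]card_ord max_card.
by move: a1 sa; case: (parts a) => [|[|x] s] //=; rewrite n0.
Qed.

Lemma of_descentsK n (A : {set 'I_n}) :
  {in A, forall i : 'I_n, 0 < i} -> descents (of_descents A) = A.
Proof.
move=> A0; apply/setP => i; rewrite mem_descents /= /parts_of_descents.
have n0 : 0 < n := leq_ltn_trans (leq0n i) (ltn_ord i).
rewrite (all_filterP _); last first.
  apply: pairmap_gt0; rewrite (path_sortedE ltn_trans) sorted_rcons_image andbT.
  rewrite all_rcons n0 /=; apply/allP => m /mapP[j]; rewrite mem_enum => /A0 + ->.
  by [].
rewrite scanl_pairmap ?path_leq_rcons_image // mem_rcons inE ltn_eqF //=.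
by rewrite (mem_map val_inj) mem_enum.
Qed.

HB.instance Definition _ n : isFinite (composition n) := CanIsFinite (@descentsK n).

Definition compl n (a : composition n) : composition n :=
  of_descents ([set i : 'I_n | 0 < i] :\: descents a).

Lemma descents_compl n (a : composition n) :
  descents (compl a) = [set i : 'I_n | 0 < i] :\: descents a.
Proof. by apply: of_descentsK => i; rewrite !inE => /andP[]. Qed.

(* Refinement order: a is finer than b. *)
Definition refines n (a b : composition n) : bool :=
  descents b \subset descents a.

Definition cstat n (a b : composition n) : nat :=
  \sum_(i in descents a :&: descents b) i.

Local Open Scope ring_scope.

(* C(q,t), as the fraction field of C[q][t]; t is the outer variable. *)
Definition ratfun (R : realType) : fieldType := {fraction {poly {poly R[i]}}}.

Definition tvar (R : realType) : ratfun R := tofrac ('X : {poly {poly R[i]}}).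

(* The free associative algebra is the algebra of the free monoid on the
   alphabet nat, the letter i standing for the generator h_{i+1}. *)
Definition ncsym (R : realType) : lalgType (ratfun R) :=
  {malg (ratfun R)[{fmonom nat}]}.

(* Only meant for i > 0. *)
Definition hgen (R : realType) (i : nat) : ncsym R :=
  (<< fmu i.-1 >> : {malg (ratfun R)[{fmonom nat}]}).

Definition hcomp (R : realType) n (a : composition n) : ncsym R :=
  \prod_(i <- parts a) hgen R i.

(* The truncated subtraction is harmless: refines a b gives size b <= size a. *)
Definition ribbon (R : realType) n (a : composition n) : ncsym R :=
  \sum_(b : composition n | refines a b)
    (-1) ^+ (size a - size b) *: hcomp R b.

(* Only meant for refines a g. *)
Definition gamma_ribbon (R : realType) n (g a : composition n) : ncsym R :=
  \sum_(b : composition n |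
          refines a b && (descents a :\: descents b \subset descents g))
    tvar R ^+ cstat a (compl b) *: ribbon R b.

(* Main.v *)
(* Expanding both sides in ribbons, [ribbon delta] gets on the right one term
   for each beta between delta and alpha such that the descents removed from
   alpha to beta avoid D(gammat) and those removed from beta to delta lie in
   D(gammat). Only D(beta) = D(delta) :|: D(gammat) qualifies, and the exponents
   add up because they are the sums of the descents removed. *)
Require Import Defs.
From mathcomp Require Import all_boot all_order all_algebra.
From mathcomp Require Import reals.

Import GRing.Theory.

Lemma descents_gt0 n (a : composition n) (i : 'I_n) : i \in descents a -> 0 < i.
Proof.
rewrite mem_descents; have [a1 _] := andP (compositionP a).
by have := path_scanl 0 a1; rewrite (path_sortedE ltn_trans) => /andP[/allP + _]; apply.
Qed.

(** Descents are positive, so the cut to positive indices in [compl] removes nothing from D(a): the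
    exponent of [t] only records the descents lost from [a] to [b]. *)
Lemma cstat_compl n (a b : composition n) :
  cstat a (compl b) = \sum_(i in descents a :\: descents b) i.
Proof.
apply: eq_bigl => i; rewrite descents_compl !in_setI !in_setD (in_set (fun i : 'I_n => 0 < i)) andbCA.
by case: (boolP (i \in descents a)) => [/descents_gt0 ->|]; rewrite ?andbF.
Qed.

(** A descent lost from [a] to [d] is lost in the second stage if it lies in D(b), and in the first
    otherwise. *)
Lemma cstat_compl_trans n (a b d : composition n) : refines a b -> refines b d ->
  cstat a (compl b) + cstat b (compl d) = cstat a (compl d).
Proof.
move=> /subsetP ab /subsetP bd; rewrite !cstat_compl.
rewrite [RHS](big_setID (descents b)) /= addnC.
congr (_ + _); apply: eq_bigl => i; rewrite ?in_setI !in_setD.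
- by have /implyP := ab i; case: (_ \in descents b) (_ \in descents a) => [] [];
    rewrite ?andbF ?andbT.
- by have /implyP := bd i; case: (_ \in descents d) (_ \in descents b) => [] [];
    rewrite ?andbF ?andbT.
Qed.

(** The coarsest common refinement. The name refers to the union of descent sets; in the order where
    finer is smaller it is a meet. *)
Definition join {n} (a b : composition n) : composition n :=
  of_descents (descents a :|: descents b).

Lemma descents_join {n} (a b : composition n) :
  descents (join a b) = descents a :|: descents b.
Proof. by apply: of_descentsK => i; rewrite in_setU => /orP[] /descents_gt0. Qed.

(** Since H lies in A and nothing of H is lost from A to B, B contains H; since only elements of H
    are lost from B to D, B has nothing beyond D and H. *)
Lemma intermediate_setP (T : finType) (A B D G H : {set T}) :
  H \subset G -> G \subset A ->
  [&& B \subset A, A :\: B \subset G :\: H, D \subset B & B :\: D \subset H] =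
  [&& D \subset A, A :\: D \subset G & B == D :|: H].
Proof.
move=> /subsetP HG /subsetP GA.
apply/and4P/and3P => [[/subsetP BA /subsetP AB /subsetP DB /subsetP BD]|].
- split.
  + by apply/subsetP => i /DB /BA.
  + apply/subsetP => i; rewrite inE => /andP[iD iA].
    case: (boolP (i \in B)) => iB; first by apply/HG/BD; rewrite inE iD.
    by have := AB i; rewrite !inE iB iA => /(_ isT) /andP[].
  + apply/eqP/setP => i; rewrite inE; apply/idP/orP => [iB|[/DB //|iH]].
      case: (boolP (i \in D)) => iD; [by left | right].
      by apply: BD; rewrite inE iD.
    apply: contraT => iB; have := AB i.
    by rewrite !inE iB iH (GA _ (HG _ iH)) => /(_ isT).
- case=> /subsetP DA /subsetP AD /eqP ->; split.
  + by apply/subsetP => i; rewrite inE => /orP[/DA|/HG /GA].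
  + apply/subsetP => i; rewrite !inE negb_or => /andP[/andP[iD ->] iA].
    by apply: AD; rewrite inE iD.
  + exact: subsetUl.
  + by apply/subsetP => i; rewrite !inE; case: (i \in D).
Qed.

Local Open Scope ring_scope.

(** The argument only reindexes a double sum over compositions, so arbitrary vectors [r] and an
    arbitrary scalar [t] stand for the ribbons and [tvar]. *)
Lemma gamma_sum_branching (K : pzRingType) (V : lmodType K) (t : K) n
    (r : composition n -> V) (alpha gamma gammat : composition n) :
  refines gamma gammat -> refines alpha gamma ->
  \sum_(delta | refines alpha delta &&
      (descents alpha :\: descents delta \subset descents gamma))
    t ^+ cstat alpha (compl delta) *: r delta =
  \sum_(beta | refines alpha beta &&
      (descents alpha :\: descents beta \subset descents gamma :\: descents gammat))
    t ^+ cstat alpha (compl beta) *: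
      \sum_(delta | refines beta delta &&
          (descents beta :\: descents delta \subset descents gammat))
        t ^+ cstat beta (compl delta) *: r delta.
Proof.
move=> le_gamma le_alpha.
have intermediate (beta delta : composition n) :
  (refines alpha beta &&
    (descents alpha :\: descents beta \subset descents gamma :\: descents gammat)) &&
  (refines beta delta && (descents beta :\: descents delta \subset descents gammat)) =
  (refines alpha delta && (descents alpha :\: descents delta \subset descents gamma)) &&
  (beta == join delta gammat).
  (* A composition is determined by its descent set, so the claim becomes one about sets. *)
  rewrite -(can_eq (@descentsK n)) descents_join /refines -!andbA.
  exact: intermediate_setP.
under [RHS]eq_bigr => beta _ do rewrite scaler_sumr.
under [RHS]eq_bigr => beta _ do under eq_bigr => delta _ do rewrite scalerA -exprD.
rewrite (exchange_big_dep (fun delta : composition n => refines alpha delta &&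
  (descents alpha :\: descents delta \subset descents gamma))) /=; last first.
  by move=> beta delta Pb Pd; have := intermediate beta delta; rewrite Pb Pd => /esym /andP[].
apply: eq_bigr => delta Pd.
rewrite (big_pred1 (join delta gammat)) => [|beta]; last by rewrite /= intermediate Pd.
(* Read at [beta = join delta gammat], the equivalence yields both refinements needed to add the
   exponents. *)
have := intermediate (join delta gammat) delta; rewrite Pd eqxx.
by case/andP=> /andP[ab _] /andP[bd _]; rewrite cstat_compl_trans.
Qed.

Theorem theorem10 (R : realType) (n : nat) (gamma gammat : composition n)
    (le_gamma : refines gamma gammat) (alpha : composition n)
    (le_alpha : refines alpha gamma) :
  gamma_ribbon R gamma alpha =
  \sum_(beta : composition n |
          refines alpha beta &&
          (descents alpha :\: descents beta
             \subset descents gamma :\: descents gammat))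
    tvar R ^+ cstat alpha (compl beta) *: gamma_ribbon R gammat beta.
Proof. exact: gamma_sum_branching. Qed.
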